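(* (In $\mathbf{ZF}$.) Let $\mathbf{X}$ be a first-countable, $\mathcal{K}$-Loeb $T_3$-space. Then $\mathbf{X}$ is a very $k$-space if and only if $\mathbf{X}$ is Fréchet-Urysohn.
   Context: The result is a theorem of $\mathbf{ZF}$ (Zermelo–Fraenkel set theory without the axiom of choice). A topological space is $\mathcal{K}$-Loeb if the family of all its non-empty compact subsets has a choice function. A space $\mathbf{X}$ is a $k$-space if it is Hausdorff and every set $A\subseteq X$, such that $A\cap K$ is closed in $\mathbf{X}$ for every compact $K\subseteq X$, is closed in $\mathbf{X}$. A very $k$-space is a space every subspace of which is a $k$-space. A space $\mathbf{X}$ is Fréchet-Urysohn if, for every $A\subseteq X$ and every $x$ in the closure of $A$, there is a sequence of points of $A$ converging in $\mathbf{X}$ to $x$. A $T_3$-space is a regular $T_1$-space. *)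

(* Defs.v *)
(** * First-order ZF *)

(** Formulas of the language of set theory, with de Bruijn indices. *)
Inductive formula : Type :=
| FMem (i j : nat)
| FEq (i j : nat)
| FFalse
| FImp (p q : formula)
| FAnd (p q : formula)
| FOr (p q : formula)
| FAll (p : formula)
| FEx (p : formula).

Definition env_cons {V : Type} (x : V) (rho : nat -> V) (i : nat) : V :=
  match i with
  | O => x
  | S j => rho j
  end.

Fixpoint sat {V : Type} (mem : V -> V -> Prop) (rho : nat -> V)
    (p : formula) : Prop :=
  match p with
  | FMem i j => mem (rho i) (rho j)
  | FEq i j => rho i = rho j
  | FFalse => False
  | FImp p q => sat mem rho p -> sat mem rho q
  | FAnd p q => sat mem rho p /\ sat mem rho q
  | FOr p q => sat mem rho p \/ sat mem rho q
  | FAll p => forall x, sat mem (env_cons x rho) p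
  | FEx p => exists x, sat mem (env_cons x rho) p
  end.

(** A model of ZF (without choice), with equality interpreted as equality.
    Separation and Replacement are the first-order schemes, with parameters
    given by [rho].  Quantifying them over arbitrary predicates of Rocq instead
    would only admit second-order models, which inherit the axiom of choice
    from a metatheory that has it. *)
Record ZF_model : Type := {
  carrier :> Type;
  mem : carrier -> carrier -> Prop;

  zf_extensionality : forall a b : carrier,
    (forall x, mem x a <-> mem x b) -> a = b;
  zf_regularity : forall a : carrier,
    (exists x, mem x a) ->
    exists x, mem x a /\ ~ (exists y, mem y x /\ mem y a);
  zf_pairing : forall a b : carrier,
    exists c, forall x, mem x c <-> x = a \/ x = b;
  zf_union : forall a : carrier,
    exists b, forall x, mem x b <-> exists y, mem y a /\ mem x y;
  zf_power_set : forall a : carrier,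
    exists b, forall x, mem x b <-> (forall y, mem y x -> mem y a);
  zf_infinity : exists w : carrier,
    (exists e, mem e w /\ forall x, ~ mem x e) /\
    (forall n, mem n w ->
       exists m, mem m w /\ forall x, mem x m <-> mem x n \/ x = n);
  zf_separation : forall (p : formula) (rho : nat -> carrier) (a : carrier),
    exists b, forall x, mem x b <-> mem x a /\ sat mem (env_cons x rho) p;
  zf_replacement : forall (p : formula) (rho : nat -> carrier) (a : carrier),
    (forall x y z,
       mem x a ->
       sat mem (env_cons x (env_cons y rho)) p ->
       sat mem (env_cons x (env_cons z rho)) p -> y = z) ->
    exists b, forall y, mem y b <->
      exists x, mem x a /\ sat mem (env_cons x (env_cons y rho)) p
}.

Declare Scope zf_scope.
Notation "x ∈ a" := (mem _ x a) (at level 70, no associativity) : zf_scope.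
Notation "x ∉ a" := (~ mem _ x a) (at level 70, no associativity) : zf_scope.
Open Scope zf_scope.

(** From here on every quantifier ranges over the sets of a model [M]: each
    definition is the interpretation in [M] of a formula of set theory. *)

(** * Basic set theory inside a model *)

Definition subset {M : ZF_model} (a b : M) : Prop := forall x, x ∈ a -> x ∈ b.

Definition is_empty {M : ZF_model} (a : M) : Prop := forall x, x ∉ a.

Definition is_inter {M : ZF_model} (c a b : M) : Prop :=
  forall x, x ∈ c <-> x ∈ a /\ x ∈ b.

Definition is_diff {M : ZF_model} (c a b : M) : Prop :=
  forall x, x ∈ c <-> x ∈ a /\ x ∉ b.

Definition is_union {M : ZF_model} (u a : M) : Prop :=
  forall x, x ∈ u <-> exists y, y ∈ a /\ x ∈ y.

Definition is_pair {M : ZF_model} (p x y : M) : Prop :=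
  forall z, z ∈ p <-> z = x \/ z = y.

(** Kuratowski pair. *)
Definition is_opair {M : ZF_model} (p x y : M) : Prop :=
  exists s d : M, is_pair s x x /\ is_pair d x y /\ is_pair p s d.

(** [app f x y]: the pair of [x] and [y] belongs to [f]. *)
Definition app {M : ZF_model} (f x y : M) : Prop :=
  exists p : M, is_opair p x y /\ p ∈ f.

Definition is_function {M : ZF_model} (f a b : M) : Prop :=
  (forall p, p ∈ f -> exists x y, x ∈ a /\ y ∈ b /\ is_opair p x y) /\
  (forall x, x ∈ a -> exists! y, app f x y).

Definition is_injection {M : ZF_model} (f a b : M) : Prop :=
  is_function f a b /\
  (forall x x' y, app f x y -> app f x' y -> x = x').

Definition is_bijection {M : ZF_model} (f a b : M) : Prop :=
  is_injection f a b /\ (forall y, y ∈ b -> exists x, x ∈ a /\ app f x y).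

Definition is_succ {M : ZF_model} (m n : M) : Prop :=
  forall x, x ∈ m <-> x ∈ n \/ x = n.

Definition inductive {M : ZF_model} (w : M) : Prop :=
  (exists e, e ∈ w /\ is_empty e) /\
  (forall n, n ∈ w -> exists m, m ∈ w /\ is_succ m n).

Definition is_omega {M : ZF_model} (w : M) : Prop :=
  inductive w /\ (forall v, inductive v -> subset w v).

Definition finite {M : ZF_model} (a : M) : Prop :=
  exists w n f : M, is_omega w /\ n ∈ w /\ is_bijection f n a.

Definition countable {M : ZF_model} (a : M) : Prop :=
  exists w f : M, is_omega w /\ is_injection f a w.

(** [f] is a choice function of the family [c]. *)
Definition is_choice_function {M : ZF_model} (f c : M) : Prop :=
  exists u : M, is_union u c /\ is_function f c u /\
    (forall k y, app f k y -> y ∈ k).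

(** * Topology inside a model

    A space is given by its underlying set [X] and its family [T] of open
    sets. *)

Definition is_topology {M : ZF_model} (X T : M) : Prop :=
  (forall U, U ∈ T -> subset U X) /\
  (exists e, e ∈ T /\ is_empty e) /\
  X ∈ T /\
  (forall U V W, U ∈ T -> V ∈ T -> is_inter W U V -> W ∈ T) /\
  (forall S W, subset S T -> is_union W S -> W ∈ T).

Definition closed {M : ZF_model} (X T A : M) : Prop :=
  subset A X /\ exists C, is_diff C X A /\ C ∈ T.

(** [x] belongs to the closure of [A], the intersection of all closed supersets
    of [A]. *)
Definition in_closure {M : ZF_model} (X T A x : M) : Prop :=
  x ∈ X /\ (forall C, closed X T C -> subset A C -> x ∈ C).

Definition is_subspace_topology {M : ZF_model} (T Y S : M) : Prop :=
  forall W, W ∈ S <-> exists U, U ∈ T /\ is_inter W U Y.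

Definition covers {M : ZF_model} (S K : M) : Prop :=
  forall x, x ∈ K -> exists U, U ∈ S /\ x ∈ U.

Definition compact {M : ZF_model} (X T K : M) : Prop :=
  subset K X /\
  (forall S, subset S T -> covers S K ->
     exists F, subset F S /\ finite F /\ covers F K).

Definition K_Loeb {M : ZF_model} (X T : M) : Prop :=
  exists c f : M,
    (forall K, K ∈ c <-> compact X T K /\ ~ is_empty K) /\
    is_choice_function f c.

Definition T1_space {M : ZF_model} (X T : M) : Prop :=
  forall x y, x ∈ X -> y ∈ X -> x <> y ->
    exists U, U ∈ T /\ x ∈ U /\ y ∉ U.

Definition hausdorff {M : ZF_model} (X T : M) : Prop :=
  forall x y, x ∈ X -> y ∈ X -> x <> y ->
    exists U V, U ∈ T /\ V ∈ T /\ x ∈ U /\ y ∈ V /\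
      ~ (exists z, z ∈ U /\ z ∈ V).

Definition regular {M : ZF_model} (X T : M) : Prop :=
  forall x C, x ∈ X -> closed X T C -> x ∉ C ->
    exists U V, U ∈ T /\ V ∈ T /\ x ∈ U /\ subset C V /\
      ~ (exists z, z ∈ U /\ z ∈ V).

Definition T3_space {M : ZF_model} (X T : M) : Prop :=
  regular X T /\ T1_space X T.

Definition is_local_base {M : ZF_model} (T x B : M) : Prop :=
  (forall U, U ∈ B -> U ∈ T /\ x ∈ U) /\
  (forall V, V ∈ T -> x ∈ V -> exists U, U ∈ B /\ subset U V).

Definition first_countable {M : ZF_model} (X T : M) : Prop :=
  forall x, x ∈ X -> exists B, countable B /\ is_local_base T x B.

Definition k_space {M : ZF_model} (X T : M) : Prop :=
  hausdorff X T /\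
  (forall A, subset A X ->
     (forall K, compact X T K -> forall B, is_inter B A K -> closed X T B) ->
     closed X T A).

Definition very_k_space {M : ZF_model} (X T : M) : Prop :=
  forall Y S, subset Y X -> is_subspace_topology T Y S -> k_space Y S.

(** [s], a function on [w] = omega, converges to [x]; for natural numbers
    [N = n \/ N ∈ n] means that [N] is at most [n]. *)
Definition converges {M : ZF_model} (T w s x : M) : Prop :=
  forall U, U ∈ T -> x ∈ U ->
    exists N, N ∈ w /\
      forall n y, n ∈ w -> N = n \/ N ∈ n -> app s n y -> y ∈ U.

Definition frechet_urysohn {M : ZF_model} (X T : M) : Prop :=
  forall A x, subset A X -> in_closure X T A x ->
    exists w s : M, is_omega w /\ is_function s w A /\ converges T w s x.

(* Main.v *)
From Stdlib Require Import Classical.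
Require Import Defs.

(** A Fréchet-Urysohn Hausdorff space is a very k-space for the usual reason:
    if [x] lies in the closure of [A ⊆ Y] but not in [A], a sequence in [A]
    converging to [x] forms with [x] a compact set whose trace on [A] is not
    closed ([convergent_compact], [frechet_urysohn_very_k]).

    Conversely, let [x] lie in the closure of [A] but not in [A]. Since
    [A ∪ {x}] is a k-space in which [A] is not closed, it has a compact subset
    [K] such that every neighbourhood of [x] meets [A ∩ K]
    ([very_k_compact]). Number a countable local base [B] at [x], and let
    [E n] be the set of the points of [K] in the closures of all the members
    of [B] numbered below [n]. It is compact and, the space being [T1],
    contains a point that some [V] in [B] misses. Taking the first such [V],
    the set [E n \ V] is compact, non-empty and contained in [A], so the
    choice function on compact sets picks a point [s n] of it. By regularity,
    the closures of the members of [B] are arbitrarily small, hence [s]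
    converges to [x] ([compact_sequence]).

    Since the model satisfies Separation only for first-order formulas, every
    set used must be defined by a formula. The tactic [definability] finds the
    formula, and [relation_exists] turns a definable relation between two sets
    into a set. No choice is available in the model: where finitely many
    choices are needed, as for compactness, they come from induction on the
    natural numbers ([finite_selection], [finite_inter_nbhd]). *)

(** * Definable classes *)

(** [P] is a class of [M]: it is defined by a formula, with parameters given
    by the environment [rho]. *)
Definition definable {M : ZF_model} (P : M -> Prop) : Prop :=
  exists (rho : nat -> M) (p : formula),
    forall x, sat (mem M) (env_cons x rho) p <-> P x.

(** The variable of index [i] has the value [a]. *)
Definition lookup {V : Type} (env : nat -> V) (i : nat) (a : V) : Prop :=
  env i = a.

Lemma lookup_head {V : Type} (env : nat -> V) a : lookup (env_cons a env) 0 a.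
Proof. reflexivity. Qed.

Lemma lookup_tail {V : Type} (env : nat -> V) i a b :
  lookup env i a -> lookup (env_cons b env) (S i) a.
Proof. exact (fun h => h). Qed.

Lemma lookup_const {V : Type} (a : V) : lookup (fun _ => a) 0 a.
Proof. reflexivity. Qed.

Section Reification.
Variable M : ZF_model.
Implicit Types (env : nat -> M) (p q : formula).

Lemma sat_mem env i j a b : lookup env i a -> lookup env j b ->
  (sat (mem M) env (FMem i j) <-> a ∈ b).
Proof. unfold lookup; intros <- <-; reflexivity. Qed.

Lemma sat_eq env i j a b : lookup env i a -> lookup env j b ->
  (sat (mem M) env (FEq i j) <-> a = b).
Proof. unfold lookup; intros <- <-; reflexivity. Qed.

Lemma sat_false env : sat (mem M) env FFalse <-> False.
Proof. reflexivity. Qed.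

Lemma sat_imp env p q (P Q : Prop) :
  (sat (mem M) env p <-> P) -> (sat (mem M) env q <-> Q) ->
  (sat (mem M) env (FImp p q) <-> (P -> Q)).
Proof. simpl; tauto. Qed.

Lemma sat_and env p q (P Q : Prop) :
  (sat (mem M) env p <-> P) -> (sat (mem M) env q <-> Q) ->
  (sat (mem M) env (FAnd p q) <-> P /\ Q).
Proof. simpl; tauto. Qed.

Lemma sat_or env p q (P Q : Prop) :
  (sat (mem M) env p <-> P) -> (sat (mem M) env q <-> Q) ->
  (sat (mem M) env (FOr p q) <-> P \/ Q).
Proof. simpl; tauto. Qed.

Lemma sat_all env p (P : M -> Prop) :
  (forall x, sat (mem M) (env_cons x env) p <-> P x) ->
  (sat (mem M) env (FAll p) <-> forall x, P x).
Proof. intros h; split; intros k x; apply h, k. Qed.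

Lemma sat_ex env p (P : M -> Prop) :
  (forall x, sat (mem M) (env_cons x env) p <-> P x) ->
  (sat (mem M) env (FEx p) <-> exists x, P x).
Proof. intros h; split; intros [x k]; exists x; apply h, k. Qed.

End Reification.

Ltac find_index :=
  lazymatch goal with
  | |- lookup (env_cons ?a _) _ ?a => exact (lookup_head _ a)
  | |- lookup (env_cons _ _) _ _ => apply lookup_tail; find_index
  | |- lookup (fun _ => ?a) _ ?a => exact (lookup_const a)
  end.

(** Finds the formula, an existential variable [?p], in a goal [sat _ env ?p <-> P] by recursion on [P],
    unfolding the notions of set theory that occur in it. *)
Ltac reify :=
  cbv beta;
  lazymatch goal with
  | |- _ <-> mem _ _ _ => apply sat_mem; find_index
  | |- _ <-> _ = _ => apply sat_eq; find_index
  | |- _ <-> False => apply sat_false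
  | |- _ <-> (_ /\ _) => apply sat_and; reify
  | |- _ <-> (_ \/ _) => apply sat_or; reify
  | |- _ <-> (exists _, _) => apply sat_ex; intro; reify
  | |- _ <-> (_ <-> _) => apply sat_and; apply sat_imp; reify
  | |- _ <-> (~ _) => apply sat_imp; [reify | apply sat_false]
  | |- _ <-> (?P -> ?Q) => apply sat_imp; reify
  | |- _ <-> (forall _, _) => apply sat_all; intro; reify
  | |- _ <-> _ =>
      progress unfold finite, is_bijection, is_injection, is_function,
        is_omega, inductive, is_succ, app, is_opair, is_pair, is_empty,
        is_inter, is_diff, subset, unique; reify
  end.

(** Proves [definable P], with all the sets of the context as parameters. *)
Ltac definability :=
  let rec collect env :=
    match goal with
    | x : carrier _ |- _ =>
        lazymatch env with
        | context [x] => fail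
        | _ => collect constr:(env_cons x env)
        end
    | _ => exists env
    end in
  match goal with
  | x : carrier _ |- _ => collect constr:(fun _ : nat => x)
  end;
  eexists; intro; reify.

(** * Elementary sets and relations *)

Section Sets.
Context {M : ZF_model}.
Implicit Types a b c e f g i j m n p r w x y z : M.

Lemma separation a (P : M -> Prop) : definable P ->
  exists b, forall x, x ∈ b <-> x ∈ a /\ P x.
Proof.
  intros (rho & p & h). destruct (zf_separation M p rho a) as [b hb].
  exists b. intros x. rewrite hb, h. reflexivity.
Qed.

Lemma adjoin_exists a b : exists c, forall x, x ∈ c <-> x ∈ a \/ x = b.
Proof.
  destruct (zf_pairing M b b) as [s hs].
  destruct (zf_pairing M a s) as [d hd].
  destruct (zf_union M d) as [c hc].
  exists c. intros x. rewrite hc. split.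
  - intros (y & hy & hx). apply hd in hy as [-> | ->]; auto.
    apply hs in hx. tauto.
  - intros [h | ->].
    + exists a. split; [apply hd; auto | exact h].
    + exists s. split; [apply hd; auto | apply hs; auto].
Qed.

Lemma union2_exists a b : exists c, forall x, x ∈ c <-> x ∈ a \/ x ∈ b.
Proof.
  destruct (zf_pairing M a b) as [d hd].
  destruct (zf_union M d) as [c hc].
  exists c. intros x. rewrite hc. split.
  - intros (y & hy & hx). apply hd in hy as [-> | ->]; auto.
  - intros [h | h]; [exists a | exists b]; rewrite hd; auto.
Qed.

Lemma inter_exists a b : exists c, is_inter c a b.
Proof. apply separation. definability. Qed.

Lemma diff_exists a b : exists c, is_diff c a b.
Proof. apply (separation a (fun x => x ∉ b)). definability. Qed.

Lemma mem_irrefl x : x ∉ x.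
Proof.
  intros h. destruct (zf_pairing M x x) as [s hs].
  destruct (zf_regularity M s) as (y & hy & hn).
  - exists x. apply hs; auto.
  - apply hs in hy. assert (y = x) as -> by tauto.
    apply hn. exists x. split; [exact h | apply hs; auto].
Qed.

Lemma opair_exists x y : exists p, is_opair p x y.
Proof.
  destruct (zf_pairing M x x) as [s hs].
  destruct (zf_pairing M x y) as [d hd].
  destruct (zf_pairing M s d) as [p hp].
  exists p, s, d. auto.
Qed.

Lemma opair_inj p x y x' y' :
  is_opair p x y -> is_opair p x' y' -> x = x' /\ y = y'.
Proof.
  intros (s & d & hs & hd & hp) (s' & d' & hs' & hd' & hp').
  assert (x = x') as <-.
  { assert (h : s = s' \/ s = d') by (apply hp', hp; auto).
    assert (k : x' = x \/ x' = x); [| intuition congruence].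
    destruct h as [<- | <-]; apply hs; [apply hs' | apply hd']; auto. }
  split; [reflexivity |].
  assert (hy : y = x \/ y = y').
  { assert (h : d = s' \/ d = d') by (apply hp', hp; auto).
    assert (k : y ∈ d) by (apply hd; auto).
    destruct h as [-> | ->]; [apply hs' in k | apply hd' in k]; tauto. }
  assert (hy' : y' = x \/ y' = y).
  { assert (h : d' = s \/ d' = d) by (apply hp, hp'; auto).
    assert (k : y' ∈ d') by (apply hd'; auto).
    destruct h as [-> | ->]; [apply hs in k | apply hd in k]; tauto. }
  intuition congruence.
Qed.

(** A class of ordered pairs contained in the product of two sets is a set:
    the pairs are elements of the double power set of the union. *)
Lemma relation_exists a b (R : M -> M -> Prop) :
  (forall x y, R x y -> x ∈ a /\ y ∈ b) ->
  definable (fun p => exists x y, is_opair p x y /\ R x y) ->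
  exists r, (forall p, p ∈ r -> exists x y, is_opair p x y /\ R x y) /\
    (forall x y, app r x y <-> R x y).
Proof.
  intros hR hdef.
  destruct (union2_exists a b) as [u hu].
  destruct (zf_power_set M u) as [v hv].
  destruct (zf_power_set M v) as [z hz].
  destruct (separation z _ hdef) as [r hr].
  exists r. split.
  - intros p hp. apply hr in hp. tauto.
  - intros x y. split.
    + intros (p & hp & h). apply hr in h as (_ & x' & y' & hp' & h).
      destruct (opair_inj _ _ _ _ _ hp hp') as [-> ->]. exact h.
    + intros h. destruct (opair_exists x y) as [p hp].
      exists p. split; [exact hp |].
      apply hr. split; [| exists x, y; auto].
      destruct (hR _ _ h) as [hx hy].
      destruct hp as (s & d & hs & hd & hp).
      apply hz. intros t ht. apply hv. intros k hk. apply hu.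
      apply hp in ht as [-> | ->];
        [apply hs in hk as [-> | ->] | apply hd in hk as [-> | ->]]; auto.
Qed.

Lemma function_exists a b (R : M -> M -> Prop) :
  (forall x y, R x y -> x ∈ a /\ y ∈ b) ->
  (forall x, x ∈ a -> exists y, R x y) ->
  (forall x y z, R x y -> R x z -> y = z) ->
  definable (fun p => exists x y, is_opair p x y /\ R x y) ->
  exists f, is_function f a b /\ forall x y, app f x y <-> R x y.
Proof.
  intros hR htot hfun hdef.
  destruct (relation_exists a b R hR hdef) as (f & hf & happ).
  exists f. split; [split | exact happ].
  - intros p hp. destruct (hf p hp) as (x & y & h & h').
    destruct (hR _ _ h'). exists x, y; auto.
  - intros x hx. destruct (htot x hx) as [y hy]. exists y.
    split; [apply happ, hy |].
    intros y' h'. apply happ in h'. exact (hfun _ _ _ hy h').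
Qed.

Lemma function_app f a b x y : is_function f a b -> app f x y -> x ∈ a /\ y ∈ b.
Proof.
  intros [h _] (p & hp & hin). destruct (h p hin) as (x' & y' & hx & hy & hp').
  destruct (opair_inj _ _ _ _ _ hp hp') as [-> ->]. auto.
Qed.

Lemma function_unique f a b x y z :
  is_function f a b -> app f x y -> app f x z -> y = z.
Proof.
  intros h hy hz. destruct (function_app _ _ _ _ _ h hy) as [hx _].
  destruct (proj2 h x hx) as (t & _ & ht).
  rewrite <- (ht y hy). apply ht, hz.
Qed.

Lemma function_total f a b x :
  is_function f a b -> x ∈ a -> exists y, y ∈ b /\ app f x y.
Proof.
  intros h hx. destruct (proj2 h x hx) as (y & hy & _). exists y.
  split; [apply (function_app _ _ _ _ _ h hy) | exact hy].
Qed.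

(** * Natural numbers *)

Lemma omega_ind w (P : M -> Prop) : is_omega w -> definable P ->
  (forall e, is_empty e -> P e) ->
  (forall n m, n ∈ w -> m ∈ w -> is_succ m n -> P n -> P m) ->
  forall n, n ∈ w -> P n.
Proof.
  intros [[(e & hew & he) hs] hmin] hdef h0 hS.
  destruct (separation w P hdef) as [v hv].
  assert (hi : inductive v).
  { split.
    - exists e. split; [apply hv; auto | exact he].
    - intros n hn. apply hv in hn as [hn hP].
      destruct (hs n hn) as (m & hm & hnm). exists m.
      split; [apply hv; eauto | exact hnm]. }
  intros n hn. apply (hmin v hi) in hn. apply hv in hn. tauto.
Qed.

(** Natural numbers are transitive sets. *)
Lemma omega_transitive w n : is_omega w -> n ∈ w ->
  forall i, i ∈ n -> subset i n.
Proof.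
  intros hw. revert n. refine (omega_ind w _ hw _ _ _).
  - definability.
  - intros e he i hi. destruct (he i hi).
  - intros n m _ _ hm IH i hi x hx. apply hm. left.
    apply hm in hi as [hi | ->]; [exact (IH i hi x hx) | exact hx].
Qed.

Lemma omega_total w n m : is_omega w -> n ∈ w -> m ∈ w ->
  m ∈ n \/ m = n \/ n ∈ m.
Proof.
  intros hw hn. revert m.
  (* First, [i < m] implies [i + 1 <= m]. *)
  assert (hsucc : forall m, m ∈ w ->
            forall i j, i ∈ m -> is_succ j i -> j ∈ m \/ j = m).
  { refine (omega_ind w _ hw _ _ _).
    - definability.
    - intros e he i j hi. destruct (he i hi).
    - intros k m _ _ hm IH i j hi hj. apply hm in hi as [hi | ->].
      + left. apply hm. exact (IH i j hi hj).
      + right. apply zf_extensionality. intros x.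
        rewrite (hm x), (hj x). reflexivity. }
  revert n hn. refine (omega_ind w _ hw _ _ _).
  - definability.
  - intros e he. refine (omega_ind w _ hw _ _ _).
    + definability.
    + intros e' he'. right; left. apply zf_extensionality. intros x.
      split; intros hx; [destruct (he' x hx) | destruct (he x hx)].
    + intros k m _ _ hm [h | [<- | h]].
      * destruct (he _ h).
      * right; right. apply hm; auto.
      * right; right. apply hm; auto.
  - intros n n' _ _ hn' IH m hm. destruct (IH m hm) as [h | [-> | h]].
    + left. apply hn'; auto.
    + left. apply hn'; auto.
    + destruct (hsucc m hm n n' h hn') as [h' | <-]; auto.
Qed.

(** * Finite sets *)

Lemma finite_empty w e : is_omega w -> is_empty e -> finite e.
Proof.
  intros hw he. destruct hw as [[(z & hz & hz') hs] hmin].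
  exists w, z, e. split; [split; [split; eauto | exact hmin] |].
  split; [exact hz |].
  assert (hn : forall x y, ~ app e x y).
  { intros x y (p & _ & hp). exact (he p hp). }
  split; [split; [split |] |].
  - intros p hp. destruct (he p hp).
  - intros x hx. destruct (hz' x hx).
  - intros x x' y h. destruct (hn _ _ h).
  - intros y hy. destruct (he y hy).
Qed.

Lemma finite_adjoin a b c : finite a ->
  (forall x, x ∈ c <-> x ∈ a \/ x = b) -> finite c.
Proof.
  intros ha hc. destruct (classic (b ∈ a)) as [hb | hb].
  { replace c with a; [exact ha |]. apply zf_extensionality. intros x.
    rewrite hc. split; [auto | intros [h | ->]; auto]. }
  destruct ha as (w & n & f & hw & hn & (hf & hinj) & hsurj).
  destruct (proj2 (proj1 hw) n hn) as (m & hm & hnm).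
  destruct (function_exists m c
              (fun x y => app f x y \/ (x = n /\ y = b)))
    as (g & hg & happ).
  - intros x y [h | [-> ->]].
    + destruct (function_app _ _ _ _ _ hf h). rewrite (hnm x), hc. auto.
    + rewrite (hnm n), hc. auto.
  - intros x hx. apply hnm in hx as [hx | ->].
    + destruct (function_total _ _ _ _ hf hx) as (y & _ & hy). eauto.
    + eauto.
  - intros x y z [h | [-> ->]] [h' | [e ->]]; auto.
    + exact (function_unique _ _ _ _ _ _ hf h h').
    + subst x. destruct (function_app _ _ _ _ _ hf h) as [k _].
      destruct (mem_irrefl _ k).
    + destruct (function_app _ _ _ _ _ hf h') as [k _].
      destruct (mem_irrefl _ k).
  - definability.
  - exists w, m, g. split; [exact hw | split; [exact hm |]].
    split; [split; [exact hg |] |].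
    + intros x x' y h h'. apply happ in h, h'.
      destruct h as [h | [-> ->]], h' as [h' | [-> e]]; auto.
      * exact (hinj _ _ _ h h').
      * subst y. destruct (function_app _ _ _ _ _ hf h). contradiction.
      * destruct (function_app _ _ _ _ _ hf h'). contradiction.
    + intros y hy. apply hc in hy as [hy | ->].
      * destruct (hsurj y hy) as (x & hx & h). exists x.
        rewrite (hnm x), happ. auto.
      * exists n. rewrite (hnm n), happ. auto.
Qed.

(** Finite choice: from the non-empty ones among finitely many sections of a
    relation, elements can be selected. *)
Lemma finite_selection w n r : is_omega w -> n ∈ w ->
  exists F, finite F /\ (forall y, y ∈ F -> exists i, app r i y) /\
    (forall i, i ∈ n -> forall y, app r i y -> exists z, z ∈ F /\ app r i z).
Proof.
  intros hw. revert n. refine (omega_ind w _ hw _ _ _).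
  - definability.
  - intros e he. exists e. split; [exact (finite_empty w e hw he) |].
    split; [intros y hy; destruct (he y hy) | intros i hi; destruct (he i hi)].
  - intros n m _ _ hm (F & hF & hr & hsel).
    destruct (classic (exists y, app r n y)) as [[y hy] | hno].
    + destruct (adjoin_exists F y) as [G hG]. exists G.
      split; [exact (finite_adjoin F y G hF hG) | split].
      * intros z hz. apply hG in hz as [hz | ->]; eauto.
      * intros i hi z hz. apply hm in hi as [hi | ->].
        -- destruct (hsel i hi z hz) as (t & ht & h). exists t.
           rewrite hG. auto.
        -- exists y. rewrite hG. auto.
    + exists F. split; [exact hF | split; [exact hr |]].
      intros i hi z hz. apply hm in hi as [hi | ->]; [eauto |].
      destruct hno. eauto.
Qed.

End Sets.

(** * Topology *)

Section Topology.
Context {M : ZF_model}.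
Implicit Types A B C F K S T U V W X Y a f i n r s w x y z : M.

Lemma open_of_nbhds X T G : is_topology X T ->
  (forall z, z ∈ G -> exists U, U ∈ T /\ z ∈ U /\ subset U G) -> G ∈ T.
Proof.
  intros (_ & _ & _ & _ & hU) h.
  destruct (separation T (fun U => subset U G)) as [S hS]; [definability |].
  apply (hU S).
  - intros U hin. apply hS in hin. tauto.
  - intros z. split.
    + intros hz. destruct (h z hz) as (U & hUT & hzU & hsub).
      exists U. rewrite hS. auto.
    + intros (U & hin & hz). apply hS in hin as [_ hsub]. auto.
Qed.

Lemma open_inter X T U V x : is_topology X T -> U ∈ T -> V ∈ T ->
  x ∈ U -> x ∈ V ->
  exists W, W ∈ T /\ x ∈ W /\ subset W U /\ subset W V.
Proof.
  intros (_ & _ & _ & hI & _) hU hV hxU hxV.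
  destruct (inter_exists U V) as [W hW]. exists W.
  split; [exact (hI U V W hU hV hW) |].
  split; [apply hW; auto |].
  split; intros z hz; apply hW in hz; tauto.
Qed.

Lemma closure_meets X T A x : is_topology X T -> x ∈ X -> subset A X ->
  (in_closure X T A x <->
   forall U, U ∈ T -> x ∈ U -> exists a, a ∈ A /\ a ∈ U).
Proof.
  intros hT hx hA. split.
  - intros [_ h] U hU hxU. apply NNPP. intros hno.
    destruct (diff_exists X U) as [C hC].
    assert (k : x ∈ C); [| apply hC in k; tauto].
    apply h.
    + split; [intros z hz; apply hC in hz; tauto |].
      exists U. split; [| exact hU].
      intros z. rewrite (hC z). split.
      * intros hz. split; [exact (proj1 hT U hU z hz) | tauto].
      * intros [h1 h2]. apply NNPP. tauto.
    + intros a ha. apply hC. split; [exact (hA a ha) |].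
      intros haU. apply hno. eauto.
  - intros h. split; [exact hx |].
    intros C (_ & D & hD & hDT) hAC. apply NNPP. intros hn.
    destruct (h D hDT) as (a & ha & haD).
    + apply hD. auto.
    + apply hD in haD as [_ k]. exact (k (hAC a ha)).
Qed.

(** The intersection of finitely many neighbourhoods of [x], namely of the
    sections at [i ∈ n] of a relation [r], is a neighbourhood of [x]. *)
Lemma finite_inter_nbhd X T x w n r : is_topology X T -> x ∈ X ->
  is_omega w -> n ∈ w ->
  (forall i, i ∈ n ->
     exists V, V ∈ T /\ x ∈ V /\ forall z, z ∈ V -> app r i z) ->
  exists V, V ∈ T /\ x ∈ V /\ forall i, i ∈ n -> forall z, z ∈ V -> app r i z.
Proof.
  intros hT hx hw. revert n. refine (omega_ind w _ hw _ _ _).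
  - definability.
  - intros e he _. exists X. split; [apply hT | split; [exact hx |]].
    intros i hi. destruct (he i hi).
  - intros n m _ _ hm IH h.
    destruct IH as (V & hV & hxV & hVr).
    { intros i hi. apply h, hm. auto. }
    destruct (h n) as (U & hU & hxU & hUr); [apply hm; auto |].
    destruct (open_inter X T U V x hT hU hV hxU hxV)
      as (W & hW & hxW & hWU & hWV).
    exists W. split; [exact hW | split; [exact hxW |]].
    intros i hi z hz. apply hm in hi as [hi | ->]; auto.
Qed.

Lemma T1_open_complement X T y : is_topology X T -> T1_space X T -> y ∈ X ->
  exists U, U ∈ T /\ forall z, z ∈ U <-> z ∈ X /\ z <> y.
Proof.
  intros hT h1 hy.
  destruct (separation X (fun z => z <> y)) as [U hU]; [definability |].
  exists U. split; [| exact hU].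
  apply (open_of_nbhds X T U hT).
  intros z hz. apply hU in hz as [hz hne].
  destruct (h1 z y hz hy hne) as (V & hV & hzV & hyV).
  exists V. split; [exact hV | split; [exact hzV |]].
  intros t ht. apply hU. split; [exact (proj1 hT V hV t ht) |].
  intros ->. contradiction.
Qed.

Lemma T3_hausdorff X T : is_topology X T -> T3_space X T -> hausdorff X T.
Proof.
  intros hT [hr h1] x y hx hy hne.
  destruct (T1_open_complement X T y hT h1 hy) as (U & hU & hUy).
  destruct (separation X (fun z => z = y)) as [C hC]; [definability |].
  destruct (hr x C hx) as (V & W & hV & hW & hxV & hCW & hd).
  - split; [intros z hz; apply hC in hz; tauto |].
    exists U. split; [| exact hU]. intros z. rewrite (hUy z), (hC z). tauto.
  - intros h. apply hC in h. tauto.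
  - exists V, W. repeat (split; [assumption |]).
    split; [apply hCW, hC; auto | exact hd].
Qed.

Lemma subspace_exists T Y : exists S, is_subspace_topology T Y S.
Proof.
  destruct (zf_power_set M Y) as [P hP].
  destruct (separation P (fun W => exists U, U ∈ T /\ is_inter W U Y))
    as [S hS]; [definability |].
  exists S. intros W. rewrite hS. split; [tauto |].
  intros h. split; [| exact h]. destruct h as (U & _ & h).
  apply hP. intros z hz. apply h in hz. tauto.
Qed.

Lemma hausdorff_subspace X T Y S : subset Y X ->
  is_subspace_topology T Y S -> hausdorff X T -> hausdorff Y S.
Proof.
  intros hY hS h x y hx hy hne.
  destruct (h x y (hY x hx) (hY y hy) hne) as (U & V & hU & hV & hxU & hyV & hd).
  destruct (inter_exists U Y) as [U' hU'].
  destruct (inter_exists V Y) as [V' hV'].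
  exists U', V'. rewrite (hS U'), (hS V'), (hU' x), (hV' y).
  split; [eauto | split; [eauto | split; [auto | split; [auto |]]]].
  intros (z & hz & hz'). apply hU' in hz. apply hV' in hz'.
  apply hd. exists z. tauto.
Qed.

Lemma compact_closed X T K : is_topology X T -> hausdorff X T ->
  compact X T K -> closed X T K.
Proof.
  intros hT hH [hKX hK]. split; [exact hKX |].
  destruct (diff_exists X K) as [G hG]. exists G. split; [exact hG |].
  apply (open_of_nbhds X T G hT).
  intros x hx. apply hG in hx as [hx hxK].
  destruct (separation T
      (fun U => exists V, V ∈ T /\ x ∈ V /\ ~ (exists z, z ∈ U /\ z ∈ V)))
    as [S hS]; [definability |].
  destruct (hK S) as (F & hFS & (w & n & f & hw & hn & (hf & _) & hsurj) & hcov).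
  - intros U hU. apply hS in hU. tauto.
  - intros y hy. destruct (hH y x) as (U & V & hU & hV & hyU & hxV & hd); auto.
    { intros ->. contradiction. }
    exists U. rewrite (hS U). eauto 6.
  - (* Members of [F] have neighbourhoods of [x] disjoint from them; the
       intersection of finitely many of these misses [K]. *)
    destruct (relation_exists n X
      (fun i z => i ∈ n /\ z ∈ X /\ forall U, app f i U -> z ∉ U))
      as (r & _ & hr); [tauto | definability |].
    destruct (finite_inter_nbhd X T x w n r hT hx hw hn) as (V & hV & hxV & hVr).
    + intros i hi. destruct (function_total _ _ _ _ hf hi) as (U & hUF & hiU).
      destruct (proj2 (proj1 (hS U) (hFS U hUF))) as (V & hV & hxV & hd).
      exists V. split; [exact hV | split; [exact hxV |]].
      intros z hz. apply hr. split; [exact hi |].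
      split; [exact (proj1 hT V hV z hz) |].
      intros U' hU'. rewrite (function_unique _ _ _ _ _ _ hf hU' hiU).
      eauto.
    + exists V. split; [exact hV | split; [exact hxV |]].
      intros z hz. apply hG. split; [exact (proj1 hT V hV z hz) |].
      intros hzK. destruct (hcov z hzK) as (U & hU & hzU).
      destruct (hsurj U hU) as (i & hi & hiU).
      apply (proj2 (proj2 (proj1 (hr i z) (hVr i hi z hz))) U hiU hzU).
Qed.

Lemma compact_subspace X T Y S K : subset Y X ->
  is_subspace_topology T Y S -> compact Y S K -> compact X T K.
Proof.
  intros hY hS [hKY hK]. split; [intros z hz; auto |].
  intros C hCT hcov.
  destruct (separation S (fun W => exists U, U ∈ C /\ is_inter W U Y))
    as [C' hC']; [definability |].
  destruct (hK C') as (F & hFC & (w & n & f & hw & hn & (hf & _) & hsurj) & hFK).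
  - intros W hW. apply hC' in hW. tauto.
  - intros z hz. destruct (hcov z hz) as (U & hU & hzU).
    destruct (inter_exists U Y) as [W hW]. exists W.
    rewrite (hC' W), (hS W), (hW z). split; [split |]; eauto.
  - (* Only finitely many members of [C] have to be chosen, one for each
       element of [F]. *)
    destruct (relation_exists n C
      (fun i U => i ∈ n /\ U ∈ C /\ exists W, app f i W /\ is_inter W U Y))
      as (r & _ & hr); [tauto | definability |].
    destruct (finite_selection w n r hw hn) as (G & hG & hGr & hsel).
    exists G. split; [| split; [exact hG |]].
    + intros U hU. destruct (hGr U hU) as (i & hi). apply hr in hi. tauto.
    + intros z hz. destruct (hFK z hz) as (W & hW & hzW).
      destruct (hsurj W hW) as (i & hi & hiW).
      destruct (proj2 (proj1 (hC' W) (hFC W hW))) as (U & hU & hWU).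
      destruct (hsel i hi U) as (U' & hU' & h').
      { apply hr. eauto. }
      exists U'. split; [exact hU' |].
      apply hr in h' as (_ & _ & W' & hW' & hin).
      rewrite <- (function_unique _ _ _ _ _ _ hf hiW hW') in hin.
      apply hin in hzW. tauto.
Qed.

Lemma compact_closed_subset X T K C : is_topology X T -> compact X T K ->
  closed X T C -> subset C K -> compact X T C.
Proof.
  intros hT [hKX hK] [hCX (D & hD & hDT)] hCK.
  split; [exact hCX |].
  intros S hS hcov.
  destruct (adjoin_exists S D) as [S' hS'].
  destruct (hK S') as (F & hFS & hF & hFK).
  - intros U hU. apply hS' in hU as [hU | ->]; auto.
  - intros z hz. destruct (classic (z ∈ C)) as [hzC | hzC].
    + destruct (hcov z hzC) as (U & hU & hzU). exists U. rewrite (hS' U). auto.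
    + exists D. rewrite (hS' D), (hD z). auto.
  - (* The desired subcover is [F] without [D]; selecting the members of [S]
       from an enumeration of [F] shows that it is finite. *)
    destruct hF as (w & n & f & hw & hn & (hf & _) & hsurj).
    destruct (relation_exists n S (fun i U => U ∈ S /\ app f i U))
      as (r & _ & hr);
      [intros i U [hU hi]; split; [exact (proj1 (function_app _ _ _ _ _ hf hi)) | exact hU]
      | definability |].
    destruct (finite_selection w n r hw hn) as (G & hG & hGr & hsel).
    exists G. split; [| split; [exact hG |]].
    + intros U hU. destruct (hGr U hU) as (i & hi). apply hr in hi. tauto.
    + intros z hz. destruct (hFK z (hCK z hz)) as (U & hU & hzU).
      destruct (hsurj U hU) as (i & hi & hiU).
      assert (hUS : U ∈ S).
      { apply hFS, hS' in hU as [hU | ->]; [exact hU |].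
        apply hD in hzU as [_ k]. contradiction. }
      destruct (hsel i hi U) as (U' & hU' & h'); [apply hr; auto |].
      apply hr in h' as [_ h'].
      rewrite (function_unique _ _ _ _ _ _ hf hiU h') in hzU. eauto.
Qed.

(** A convergent sequence together with its limit is compact. *)
Lemma convergent_compact X T w s x A K : is_omega w -> is_function s w A ->
  converges T w s x -> subset K X ->
  (forall z, z ∈ K <-> z = x \/ exists n, app s n z) -> compact X T K.
Proof.
  intros hw hs hlim hKX hK. split; [exact hKX |].
  intros S hST hcov.
  destruct (hcov x) as (U & hU & hxU); [apply hK; auto |].
  destruct (hlim U (hST U hU) hxU) as (N & hN & htail).
  destruct (relation_exists w S
      (fun n V => n ∈ w /\ V ∈ S /\ exists y, app s n y /\ y ∈ V))
    as (r & _ & hr); [tauto | definability |].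
  (* [G] covers the terms before [N]; the set [U] covers all the others. *)
  destruct (finite_selection w N r hw hN) as (G & hG & hGr & hsel).
  destruct (adjoin_exists G U) as [F hF].
  exists F. split; [| split; [exact (finite_adjoin G U F hG hF) |]].
  - intros V hV. apply hF in hV as [hV | ->]; [| exact hU].
    destruct (hGr V hV) as (i & hi). apply hr in hi. tauto.
  - assert (hin : forall z, z ∈ U -> exists V, V ∈ F /\ z ∈ V).
    { intros z hz. exists U. rewrite (hF U). auto. }
    intros z hz. assert (hz' := hz). apply hK in hz' as [-> | (n & hnz)]; [auto |].
    destruct (function_app _ _ _ _ _ hs hnz) as [hn _].
    destruct (omega_total w N n hw hN hn) as [h | h].
    + destruct (hcov z hz) as (V & hV & hzV).
      destruct (hsel n h V) as (V' & hV' & h'); [apply hr; eauto |].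
      apply hr in h' as (_ & _ & y & hy & hyV).
      rewrite (function_unique _ _ _ _ _ _ hs hy hnz) in hyV.
      exists V'. rewrite (hF V'). auto.
    + apply hin, (htail n z hn); [destruct h; auto | exact hnz].
Qed.

(** * Fréchet-Urysohn Hausdorff spaces are very k-spaces *)

Lemma frechet_urysohn_very_k X T : is_topology X T -> hausdorff X T ->
  frechet_urysohn X T -> very_k_space X T.
Proof.
  intros hT hH hFU Y S hY hS.
  split; [exact (hausdorff_subspace X T Y S hY hS hH) |].
  intros A hA hk. split; [exact hA |].
  destruct (diff_exists Y A) as [D hD]. exists D. split; [exact hD |].
  (* [U] is the complement of the closure of [A] in [X]. *)
  destruct (separation X (fun z => exists O, O ∈ T /\ z ∈ O /\
      ~ (exists a, a ∈ A /\ a ∈ O))) as [U hU]; [definability |].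
  apply hS. exists U. split.
  { apply (open_of_nbhds X T U hT). intros z hz.
    apply hU in hz as (_ & O & hO & hzO & hd).
    exists O. split; [exact hO | split; [exact hzO |]].
    intros t ht. apply hU. split; [exact (proj1 hT O hO t ht) | eauto]. }
  intros x. rewrite (hD x). split.
  2:{ intros [hx hxY]. split; [exact hxY |]. intros hxA.
      apply hU in hx as (_ & O & _ & hxO & hd). eauto. }
  intros [hxY hxA]. split; [| exact hxY].
  apply NNPP. intros hxU.
  assert (hAX : subset A X) by (intros a ha; auto).
  destruct (hFU A x hAX) as (w & s & hw & hs & hlim).
  { apply (closure_meets X T A x hT (hY x hxY) hAX).
    intros O hO hxO. apply NNPP. intros hno. apply hxU, hU. eauto 6. }
  destruct (separation Y (fun z => z = x \/ exists n, app s n z))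
    as [K hK]; [definability |].
  assert (hK' : forall z, z ∈ K <-> z = x \/ exists n, app s n z).
  { intros z. rewrite (hK z). split; [tauto |]. intros h. split; [| exact h].
    destruct h as [-> | (n & hn)]; [exact hxY |].
    apply hA. apply (function_app _ _ _ _ _ hs hn). }
  assert (hlimY : converges S w s x).
  { intros W hW hxW. apply hS in hW as (V & hV & hW).
    destruct (hlim V hV) as (N & hN & htail); [apply hW in hxW; tauto |].
    exists N. split; [exact hN |]. intros n y hn hle hy.
    apply hW. split; [exact (htail n y hn hle hy) |].
    apply hA. apply (function_app _ _ _ _ _ hs hy). }
  assert (hcomp : compact Y S K).
  { apply (convergent_compact Y S w s x A K hw hs hlimY); [| exact hK'].
    intros z hz. apply hK in hz. tauto. }
  destruct (inter_exists A K) as [B hB].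
  destruct (hk K hcomp B hB) as (_ & E & hE & hES).
  destruct (hlimY E hES) as (N & hN & htail).
  { apply hE. split; [exact hxY |]. intros h. apply hB in h. tauto. }
  destruct (function_total _ _ _ _ hs hN) as (y & hyA & hy).
  assert (hyE := htail N y hN (or_introl eq_refl) hy).
  apply hE in hyE as [_ hyB]. apply hyB, hB.
  split; [exact hyA | apply hK'; eauto].
Qed.

(** * Extracting a convergent sequence from a compact set *)

(** Every neighbourhood of a point [x] in the closure of [A] but outside [A]
    meets [A ∩ K] for one and the same compact [K ⊆ A ∪ {x}]. *)
Lemma very_k_compact X T A x : is_topology X T -> hausdorff X T ->
  very_k_space X T -> subset A X -> in_closure X T A x -> x ∉ A ->
  exists K, compact X T K /\ (forall z, z ∈ K -> z ∈ A \/ z = x) /\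
    (forall U, U ∈ T -> x ∈ U -> exists a, a ∈ A /\ a ∈ K /\ a ∈ U).
Proof.
  intros hT hH hvk hA hcl hxA. assert (hx := proj1 hcl).
  destruct (adjoin_exists A x) as [Y hYx].
  destruct (subspace_exists T Y) as [S hS].
  assert (hY : subset Y X).
  { intros z hz. apply hYx in hz as [hz | ->]; auto. }
  apply NNPP. intros hno.
  destruct (proj2 (hvk Y S hY hS) A) as (_ & D & hD & hDS).
  { intros z hz. apply hYx. auto. }
  2:{ (* If [A] is closed in [Y], then [x] has a neighbourhood missing [A]. *)
      apply hS in hDS as (U & hU & hDU).
      assert (hxD : x ∈ D).
      { apply hD. split; [apply hYx; auto | exact hxA]. }
      destruct (proj1 (closure_meets X T A x hT hx hA) hcl U hU) as (a & ha & haU).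
      - apply hDU in hxD. tauto.
      - assert (haD : a ∈ D).
        { apply hDU. split; [exact haU | apply hYx; auto]. }
        apply hD in haD. tauto. }
  intros K hK B hB.
  assert (hKX := compact_subspace X T Y S K hY hS hK).
  destruct (compact_closed X T K hT hH hKX) as (_ & G & hG & hGT).
  assert (hO : exists O, O ∈ T /\ x ∈ O /\
                 ~ (exists a, a ∈ A /\ a ∈ K /\ a ∈ O)).
  { apply NNPP. intros hn. apply hno. exists K. split; [exact hKX | split].
    - intros z hz. apply hYx, hK, hz.
    - intros U hU hxU. apply NNPP. intros hn'. apply hn. eauto. }
  destruct hO as (O & hOT & hxO & hOd).
  split.
  { intros z hz. apply hB in hz. apply hYx. tauto. }
  destruct (diff_exists Y B) as [E hE]. exists E. split; [exact hE |].
  destruct (union2_exists G O) as [U hU].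
  apply hS. exists U. split.
  { apply (open_of_nbhds X T U hT). intros z hz.
    apply hU in hz as [hz | hz]; [exists G | exists O];
      (split; [assumption | split; [assumption |]]);
      intros t ht; apply hU; auto. }
  intros z. rewrite (hE z), (hU z), (hB z), (hG z). split.
  - intros [hzY hzB]. split; [| exact hzY].
    destruct (classic (z ∈ K)) as [hzK | hzK]; [right | left; auto].
    apply hYx in hzY as [hzA | ->]; [tauto | exact hxO].
  - intros [h hzY]. split; [exact hzY |]. intros [hzA hzK].
    destruct h as [[_ h] | h]; [contradiction | eauto].
Qed.

(** The neighbourhoods in a countable local base [B]
    at [x] are numbered by [g].  For [n] a natural number, let [E n] be the
    set of the points of [K] in the closures of the members of [B] of number
    less than [n]; for the first [V] in [B] that does not contain [E n], the
    choice function [f] is applied to the compact set [E n \ V]. *)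
Lemma compact_sequence X T K A x : is_topology X T -> first_countable X T ->
  K_Loeb X T -> T3_space X T -> compact X T K -> x ∈ X -> x ∉ A ->
  (forall z, z ∈ K -> z ∈ A \/ z = x) ->
  (forall U, U ∈ T -> x ∈ U -> exists a, a ∈ A /\ a ∈ K /\ a ∈ U) ->
  exists w s, is_omega w /\ is_function s w A /\ converges T w s x.
Proof.
  intros hT hfc (c & f & hc & u & hu & hf & hchoice) [hreg hT1] hK hx hxA hKA hacc.
  destruct (hfc x hx) as (B & (w & g & hw & hg & hginj) & hBT & hB).
  (* [H] is the relation of [n] to the points of [E n]. *)
  pose (H := fun n z => z ∈ K /\ forall U i, U ∈ B -> app g U i -> i ∈ n ->
               forall W, W ∈ T -> z ∈ W -> exists t, t ∈ W /\ t ∈ U).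
  assert (hDexists : forall n V, exists C, forall z, z ∈ C <-> H n z /\ z ∉ V).
  { intros n V.
    destruct (separation K (fun z => H n z /\ z ∉ V)) as [C hC];
      [unfold H; definability |].
    exists C. intros z. rewrite (hC z). unfold H. tauto. }
  pose (R := fun n y => n ∈ w /\ y ∈ A /\ exists V i C,
    V ∈ B /\ app g V i /\ (forall z, z ∈ C <-> H n z /\ z ∉ V) /\ app f C y /\
    forall V' i', V' ∈ B -> app g V' i' -> i' ∈ i ->
      ~ (exists z, H n z /\ z ∉ V')).
  destruct (function_exists w A R) as (s & hs & happ).
  - unfold R. tauto.
  - (* [R] is total: some [V] in [B] does not contain [E n], because a whole
       neighbourhood [O] of [x] meets [K] only in points of [E n]. *)
    intros n hn.
    assert (hbig : exists V z, V ∈ B /\ H n z /\ z ∉ V).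
    { destruct (relation_exists n X
        (fun i z => i ∈ n /\ z ∈ X /\ forall U, U ∈ B -> app g U i -> z ∈ U))
        as (r & _ & hr); [tauto | definability |].
      destruct (finite_inter_nbhd X T x w n r hT hx hw hn)
        as (O & hO & hxO & hOr).
      { intros i hi.
        destruct (classic (exists U, U ∈ B /\ app g U i)) as [(U & hU & hUi) | hno].
        - exists U. destruct (hBT U hU) as [hUT hxU].
          split; [exact hUT | split; [exact hxU |]].
          intros z hz. apply hr. split; [exact hi |].
          split; [exact (proj1 hT U hUT z hz) |].
          intros U' _ hU'i. rewrite (hginj U' U i hU'i hUi). exact hz.
        - exists X. split; [apply hT | split; [exact hx |]].
          intros z hz. apply hr. split; [exact hi | split; [exact hz |]].
          intros U hU hUi. destruct hno. eauto. }
      destruct (hacc O hO hxO) as (a & ha & haK & haO).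
      destruct (T1_open_complement X T a hT hT1) as (U & hU & hUa).
      { apply hK, haK. }
      destruct (hB U hU) as (V & hV & hVU).
      { apply hUa. split; [exact hx |]. intros ->. contradiction. }
      exists V, a. split; [exact hV | split; [split; [exact haK |] |]].
      - intros U' i hU' hUi hi W _ haW. exists a. split; [exact haW |].
        apply (proj1 (hr i a) (hOr i hi a haO)); auto.
      - intros haV. apply hVU, hUa in haV. tauto. }
    (* The least number of a neighbourhood as in [hbig]. *)
    destruct (separation w (fun i => exists V z, V ∈ B /\ app g V i /\
        H n z /\ z ∉ V)) as [I hI]; [unfold H; definability |].
    destruct (zf_regularity M I) as (i & hi & hmin).
    { destruct hbig as (V & z & hV & hz & hzV).
      destruct (function_total _ _ _ _ hg hV) as (i & hi & hVi).
      exists i. apply hI. eauto 8. }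
    apply hI in hi as (hi & V & z & hV & hVi & hz & hzV).
    destruct (hDexists n V) as [C hC].
    (* [C = E n \ V] is closed, as a point outside has the neighbourhood [V],
       the complement of [K], or a set missing a member of [B] numbered below
       [n]. *)
    assert (hCc : C ∈ c).
    { apply hc. split; [| intros h; apply (h z), hC; auto].
      apply (compact_closed_subset X T K C hT hK);
        [| intros t ht; apply hC in ht as [[ht _] _]; exact ht].
      split; [intros t ht; apply hC in ht as [[ht _] _]; apply hK, ht |].
      destruct (diff_exists X C) as [D hD]. exists D. split; [exact hD |].
      destruct (compact_closed X T K hT (T3_hausdorff X T hT (conj hreg hT1)) hK)
        as (_ & G & hG & hGT).
      apply (open_of_nbhds X T D hT). intros t ht.
      apply hD in ht as [htX htC].
      assert (hout : exists O, O ∈ T /\ t ∈ O /\ forall y, y ∈ O -> y ∉ C).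
      { destruct (classic (t ∈ V)) as [htV | htV].
        { exists V. split; [apply hBT, hV | split; [exact htV |]].
          intros y hy hyC. apply hC in hyC. tauto. }
        destruct (classic (t ∈ K)) as [htK | htK].
        2:{ exists G. split; [exact hGT | split; [apply hG; auto |]].
            intros y hy hyC. apply hG in hy as [_ hy].
            apply hC in hyC as [[hyK _] _]. contradiction. }
        apply NNPP. intros hn'. apply htC, hC. split; [| exact htV].
        split; [exact htK |]. intros U j hU hUj hj W hW htW.
        apply NNPP. intros hd. apply hn'. exists W.
        split; [exact hW | split; [exact htW |]].
        intros y hyW hyC. apply hC in hyC as [[_ hy] _].
        exact (hd (hy U j hU hUj hj W hW hyW)). }
      destruct hout as (O & hO & htO & hOC). exists O.
      split; [exact hO | split; [exact htO |]].
      intros y hy. apply hD. split; [exact (proj1 hT O hO y hy) | auto]. }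
    destruct (function_total _ _ _ _ hf hCc) as (y & _ & hy).
    exists y. split; [exact hn |]. assert (hyC := hchoice C y hy).
    apply hC in hyC as [[hyK _] hyV]. split.
    { destruct (hKA y hyK) as [h | ->]; [exact h |].
      destruct hyV. apply hBT, hV. }
    exists V, i, C. repeat (split; [assumption |]).
    intros V' i' hV' hVi' hlt (t & ht & htV). apply hmin. exists i'.
    split; [exact hlt |]. apply hI.
    split; [exact (proj2 (function_app _ _ _ _ _ hg hVi')) | eauto 8].
  - (* [R] is functional: two least numbers are equal, [g] is injective, and
       [f] is a function. *)
    intros n y y' (_ & _ & V & i & C & hV & hVi & hC & hy & hmin)
      (_ & _ & V' & i' & C' & hV' & hVi' & hC' & hy' & hmin').
    assert (hne : exists z, H n z /\ z ∉ V).
    { exists y. apply hC, (hchoice C y hy). }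
    assert (hne' : exists z, H n z /\ z ∉ V').
    { exists y'. apply hC', (hchoice C' y' hy'). }
    assert (i' = i) as ->.
    { destruct (omega_total w i i' hw) as [h | [h | h]]; auto.
      - exact (proj2 (function_app _ _ _ _ _ hg hVi)).
      - exact (proj2 (function_app _ _ _ _ _ hg hVi')).
      - destruct (hmin V' i' hV' hVi' h hne').
      - destruct (hmin' V i hV hVi h hne). }
    assert (V' = V) as -> by exact (hginj V' V i hVi' hVi).
    assert (C' = C) as ->.
    { apply zf_extensionality. intros z. rewrite (hC z), (hC' z). reflexivity. }
    exact (function_unique _ _ _ _ _ _ hf hy hy').
  - unfold R, H. definability.
  - exists w, s. split; [exact hw | split; [exact hs |]].
    intros O hO hxO.
    (* By regularity, some [U] in [B] has its closure contained in [O]. *)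
    destruct (diff_exists X O) as [Z hZ].
    destruct (hreg x Z hx) as (W & W' & hW & hW' & hxW & hZW & hd).
    { split; [intros z hz; apply hZ in hz; tauto |].
      exists O. split; [| exact hO]. intros z. rewrite (hZ z). split.
      - intros hz. split; [exact (proj1 hT O hO z hz) | tauto].
      - intros [h1 h2]. apply NNPP. tauto. }
    { intros h. apply hZ in h. tauto. }
    destruct (hB W hW hxW) as (U & hU & hUW).
    destruct (function_total _ _ _ _ hg hU) as (i & hi & hUi).
    destruct (proj2 (proj1 hw) i hi) as (N & hN & hNi).
    exists N. split; [exact hN |]. intros n y hn hle hy.
    assert (hin : i ∈ n).
    { assert (h : i ∈ N) by (apply hNi; auto).
      destruct hle as [<- | hle]; [exact h |].
      exact (omega_transitive w n hw hn N hle i h). }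
    apply happ in hy as (_ & _ & V & j & C & _ & _ & hC & hy & _).
    apply hchoice, hC in hy as [[hyK hyE] _].
    apply NNPP. intros hyO.
    destruct (hyE U i hU hUi hin W' hW') as (t & htW & htU).
    { apply hZW, hZ. split; [apply hK, hyK | exact hyO]. }
    apply hd. exists t. auto.
Qed.

Lemma very_k_frechet_urysohn X T : is_topology X T -> first_countable X T ->
  K_Loeb X T -> T3_space X T -> very_k_space X T -> frechet_urysohn X T.
Proof.
  intros hT hfc hL hT3 hvk A x hA hcl. assert (hx := proj1 hcl).
  destruct (classic (x ∈ A)) as [hxA | hxA].
  - destruct (hfc x hx) as (B & (w & g & hw & _) & _).
    destruct (function_exists w A (fun n y => n ∈ w /\ y = x))
      as (s & hs & happ).
    + intros n y [hn ->]. auto.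
    + eauto.
    + intros n y z [_ ->] [_ ->]. reflexivity.
    + definability.
    + exists w, s. split; [exact hw | split; [exact hs |]].
      intros U hU hxU. destruct (proj1 (proj1 hw)) as (e & he & _).
      exists e. split; [exact he |].
      intros n y _ _ hy. apply happ in hy as [_ ->]. exact hxU.
  - destruct (very_k_compact X T A x hT (T3_hausdorff X T hT hT3) hvk hA hcl hxA)
      as (K & hK & hKA & hacc).
    exact (compact_sequence X T K A x hT hfc hL hT3 hK hx hxA hKA hacc).
Qed.

End Topology.

Theorem theorem6p2 (M : ZF_model) (X T : M)
  (hX : is_topology X T)
  (hfc : first_countable X T)
  (hL : K_Loeb X T)
  (hT3 : T3_space X T) :
  very_k_space X T <-> frechet_urysohn X T.
Proof.
  split.
  - apply very_k_frechet_urysohn; assumption.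
  - apply frechet_urysohn_very_k; [assumption | apply T3_hausdorff; assumption].
Qed.
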